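(* Let $G$ be a cycle with $n$ vertices. There is a constant $c>0$ such that for every $N\ge1$, if $R$ and $S$ are independent random walks on $G$, then the probability that the tokens can be scheduled so that each is advanced $N$ steps along its walk without a collision is less than $e^{-cN^{1/3}}$.
   Context: A walk on $G$ is an infinite sequence $R(1),R(2),\ldots$ of vertices with consecutive vertices adjacent. A random walk on $G$: $R(1)$ uniform among vertices, each $R(i+1)$ uniform among neighbours of $R(i)$. Tokens $T_R,T_S$ start at $R(1),S(1)$; a move advances exactly one token one step along its own walk; a collision occurs if the two tokens ever occupy the same vertex at the same time (including initially). *)

(* Defs.v *)
From HB Require Import structures.
From mathcomp Require Import all_boot all_order all_algebra.
From mathcomp Require Import all_classical all_reals all_analysis.

Set Implicit Arguments.
Unset Strict Implicit.
Unset Printing Implicit Defensive.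

Import Order.TTheory GRing.Theory Num.Theory.

Local Open Scope classical_set_scope.
Local Open Scope ring_scope.

(* A simple graph with vertex set V is given by its adjacency relation
   e : rel V.  Walks are indexed from 0, so X 0 is the starting vertex. *)

(* The cyclic sequence c lists every vertex exactly once, and two vertices are
   adjacent iff they are consecutive in c. *)
Definition is_cycle_graph (V : finType) (n : nat) (e : rel V) : Prop :=
  (2 < n)%N /\
  exists c : seq V, [/\ size c = n, uniq c, forall x, x \in c &
    forall x y, e x y = (y == next c x) || (x == next c y)].

Definition uniform_neighbour (R : realType) (V : finType) (e : rel V)
    (x y : V) : R :=
  if e x y then #|[set z | e x z]%SET|%:R^-1 else 0.

(* The last clause says that, conditionally on the whole past X 0, ..., X k
   being w 0, ..., w k, the next vertex is uniform among the neighbours of w k;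
   it is written as a product so as to allow conditioning events of
   probability 0. *)
Definition random_walk (d : measure_display) (T : measurableType d)
    (R : realType) (P : probability T R) (V : finType) (e : rel V)
    (X : nat -> T -> V) : Prop :=
  [/\ forall k v, measurable [set t | X k t = v],
      forall v, P [set t | X 0%N t = v] = (#|V|%:R^-1)%:E &
      forall (k : nat) (w : nat -> V) (v : V),
        P [set t | (forall i, (i <= k)%N -> X i t = w i) /\ X k.+1 t = v] =
        (P [set t | forall i, (i <= k)%N -> X i t = w i] *
         (uniform_neighbour R e (w k) v)%:E)%E].

Definition process_sigma_algebra (T : Type) (V : finType) (X : nat -> T -> V) :
    set (set T) :=
  <<s [set A | exists k v, A = [set t | X k t = v]] >>.

Definition independent_processes (d : measure_display) (T : measurableType d)
    (R : realType) (P : probability T R) (V : finType) (X Y : nat -> T -> V) :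
    Prop :=
  forall A B : set T, process_sigma_algebra X A -> process_sigma_algebra Y B ->
    P (A `&` B) = (P A * P B)%E.

(* A schedule is the list of moves: true advances the first token, false the
   second one.  After the first k moves the tokens are at
   x (count id (take k s)) and y (count negb (take k s)). *)
Definition collision_free (V : finType) (x y : nat -> V) (s : seq bool) : Prop :=
  forall k, (k <= size s)%N ->
    x (count id (take k s)) <> y (count negb (take k s)).

Definition schedulable (V : finType) (N : nat) (x y : nat -> V) : Prop :=
  exists s : seq bool,
    [/\ count id s = N, count negb s = N & collision_free x y s].

(* Main.v *)
(* Idea. Lift both walks to Z: x follows a word w of signs, and a collision-free
   schedule keeps |x - y| < n throughout. Fix y and look at the first time x
   reaches a level l. If x then continues with a long ascent, y cannot come back
   below l - n between its first times above l + n and above l + 3n; if x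
   continues with a short ascent followed by a deep dip, y has to do so. Hence for each
   level one of the two continuations is forbidden, whatever y is, and
   reaching K well separated levels costs a factor (1 - 2^(-6n))^K. On the other
   hand x stays in a strip of width O(nK) for N steps with probability
   exp(-cN/(nK)^2). Take K about N^(1/3). *)

Require Import Defs.
From HB Require Import structures.
From mathcomp Require Import all_boot all_order all_algebra.
From mathcomp Require Import all_classical all_reals all_analysis.
From mathcomp Require Import zify ring lra.

Set Implicit Arguments.
Unset Strict Implicit.
Unset Printing Implicit Defensive.

Import Order.TTheory GRing.Theory Num.Theory.

Local Open Scope classical_set_scope.
Local Open Scope ring_scope.

(** * Sign words *)

Section Mean.
Variable R : realFieldType.

(** The expectation over a uniform sign word, by recursion on the first letter so that inductions
    condition on the next step. *)
Fixpoint mean (N : nat) (f : seq bool -> R) : R :=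
  if N is N'.+1 then
    (mean N' (fun w => f (true :: w)) + mean N' (fun w => f (false :: w))) / 2
  else f [::].

Lemma le_mean N (f g : seq bool -> R) :
  (forall w, size w = N -> f w <= g w) -> mean N f <= mean N g.
Proof.
elim: N f g => [|N IH] f g fg /=; first exact: fg.
by rewrite ler_pM2r ?invr_gt0// lerD// IH// => w sw; apply: fg; rewrite /= sw.
Qed.

Lemma eq_mean N (f g : seq bool -> R) :
  (forall w, size w = N -> f w = g w) -> mean N f = mean N g.
Proof. by move=> fg; apply/le_anti; rewrite !le_mean// => w /fg ->. Qed.

Lemma mean_cst N (a : R) : mean N (fun=> a) = a.
Proof. by elim: N => //= N ->; field. Qed.

Lemma meanD N (f g : seq bool -> R) :
  mean N (fun w => f w + g w) = mean N f + mean N g.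
Proof. by elim: N f g => //= N IH f g; rewrite !IH; field. Qed.

Lemma mean_negb N (f : seq bool -> R) : mean N (fun w => f (map negb w)) = mean N f.
Proof. by elim: N f => //= N IH f; rewrite !(IH (fun w => f (_ :: w))) addrC. Qed.

Lemma mean_tuple N (f : seq bool -> R) :
  mean N f = 2 ^- N * \sum_(w : N.-tuple bool) f w.
Proof.
elim: N f => [|N IH] f /=.
  rewrite expr0 invr1 mul1r (big_pred1 [tuple]) //= => w.
  by apply/esym/eqP; exact: tuple0.
have -> : \sum_(w : N.+1.-tuple bool) f w =
    \sum_(p : bool * N.-tuple bool) f (p.1 :: p.2).
  rewrite (reindex (fun p : bool * N.-tuple bool => [tuple of p.1 :: p.2])) //=.
  exists (fun w => (thead w, [tuple of behead w])) => [[b w] _|w _] /=.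
    by congr pair; apply: val_inj.
  by rewrite [RHS]tuple_eta; apply: val_inj.
rewrite -(pair_bigA _ (fun b (w : N.-tuple bool) => f (b :: w))) /= big_bool /= !IH.
by rewrite exprS invfM; field; rewrite expf_neq0.
Qed.

End Mean.

Definition pos (w : seq bool) : int := \sum_(b <- w) (if b then 1 else -1).

Lemma pos_nil : pos [::] = 0. Proof. exact: big_nil. Qed.
Lemma pos_cons b w : pos (b :: w) = (if b then 1 else -1) + pos w.
Proof. exact: big_cons. Qed.
Lemma pos_cat v w : pos (v ++ w) = pos v + pos w. Proof. exact: big_cat. Qed.
Lemma pos_rcons w b : pos (rcons w b) = pos w + (if b then 1 else -1).
Proof. by rewrite -cats1 pos_cat pos_cons pos_nil addr0. Qed.
Lemma pos_negb w : pos (map negb w) = - pos w.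
Proof.
by rewrite /pos big_map -sumrN; apply: eq_bigr => -[].
Qed.
Lemma pos_le_count w : pos w <= (count id w)%:Z.
Proof. by elim: w => [|[] w IH]; rewrite ?pos_nil// pos_cons /=; lia. Qed.
Lemma pos_le_size w : pos w <= (size w)%:Z.
Proof. by rewrite (le_trans (pos_le_count w))// lez_nat count_size. Qed.
Lemma pos_nseq m b : pos (nseq m b) = if b then m%:Z else - m%:Z.
Proof. by case: b; elim: m => [|m IH] /=; rewrite ?pos_nil ?pos_cons ?IH; lia. Qed.

(* The potential 2 W^2 - z^2 drops by exactly 1 on average at each step, and lies
   between W^2 and 2 W^2 inside the strip. *)
Lemma mean_strip (R : realFieldType) (W : nat) (N : nat) (z : int) : (0 < W)%N ->
  `|z| <= W%:Z ->
  W%:R ^+ 2 * mean N (fun w => `[< forall i, `|z + pos (take i w)| < W%:Z >]%:R : R)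
  <= (2 * W%:R ^+ 2 - z%:~R ^+ 2) * (1 - (2 * W%:R ^+ 2)^-1) ^+ N.
Proof.
move=> W0; have W0' : 0 < W%:R :> R by rewrite ltr0n.
set q := 1 - _; have q0 : 0 <= q.
  rewrite subr_ge0 invf_le1 ?mulr_gt0 ?exprn_gt0//.
  by rewrite -natrX -natrM ler1n; lia.
have zW z' : `|z'| <= W%:Z -> z'%:~R ^+ 2 <= W%:R ^+ 2 :> R.
  move=> zW; rewrite -[leLHS]ger0_norm ?sqr_ge0// normrX.
  by rewrite lerXn2r ?nnegrE//; rewrite -intr_norm -[W%:R]/(W%:Z%:~R) ler_int.
elim: N z => [|N IH] z zle /=.
  rewrite expr0 mulr1 (@le_trans _ _ (W%:R ^+ 2))//.
    by rewrite ler_piMr ?exprn_ge0 ?(ltW W0')// lern1 leq_b1.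
  by have := zW _ zle; lra.
have [zlt|zge] := ltP `|z| W%:Z; last first.
  have out b : mean N (fun w =>
      `[< forall i, `|z + pos (take i (b :: w))| < W%:Z >]%:R : R) = 0.
    rewrite (eq_mean (g := fun=> 0)) ?mean_cst// => w _; case: asboolP => // /(_ 0%N).
    by rewrite take0 pos_nil addr0 ltNge zge.
  rewrite !out addr0 mul0r mulr0 mulr_ge0 ?exprn_ge0//.
  by have := zW _ zle; have := sqr_ge0 (W%:R : R); lra.
have step b : W%:R ^+ 2 * mean N (fun w =>
      `[< forall i, `|z + pos (take i (b :: w))| < W%:Z >]%:R) <=
    (2 * W%:R ^+ 2 - (z + (if b then 1 else -1))%:~R ^+ 2) * q ^+ N.
  apply: le_trans (IH (z + (if b then 1 else -1)) _); last by case: b; lia.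
  rewrite ler_wpM2l ?exprn_ge0 ?(ltW W0')//; apply: le_mean => w _.
  rewrite ler_nat; case: asboolP => // H; case: asboolP => // -[] i.
  by have := H i.+1; rewrite /= pos_cons addrA.
(* The potential is at most [2 W^2], so losing 1 is losing at least the fraction [1 / (2 W^2)]. *)
have Hq : (2 * W%:R ^+ 2 - z%:~R ^+ 2) - 1 <= (2 * W%:R ^+ 2 - z%:~R ^+ 2) * q.
  rewrite /q mulrBr mulr1 lerD2l lerN2 ler_pdivrMr ?mulr_gt0 ?exprn_gt0// mul1r.
  by rewrite gerBl sqr_ge0.
apply: (@le_trans _ _ ((2 * W%:R ^+ 2 - z%:~R ^+ 2 - 1) * q ^+ N)); last first.
  by rewrite [q ^+ N.+1]exprS mulrA ler_wpM2r ?exprn_ge0.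
have := step false; have := step true.
set A := mean _ _; set B := mean _ _; set Q := q ^+ N.
by rewrite !rmorphD /= !rmorphN /= rmorph1; lra.
Qed.

(** * Forbidden patterns at first hitting times *)

(** Earlier visits to [l] are allowed: what matters is that the final position [l] is the maximum so
    far. *)
Definition first_hit (l : int) (w : seq bool) : Prop :=
  pos w = l /\ forall i, pos (take i w) <= l.

Lemma pos_take_cat_le (l b : int) v w : 0 <= b ->
  pos v = l -> (forall i, pos (take i v) <= l) ->
  (forall i, pos (take i w) <= b) -> forall i, pos (take i (v ++ w)) <= l + b.
Proof.
move=> b0 vl vle wb i; rewrite take_cat; case: ifP => _.
  by rewrite (le_trans (vle i))// lerDl.
by rewrite pos_cat vl lerD2l.
Qed.

(* Q i j: the schedule passes through the state where the first walk has made i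
   steps and the second one j steps. *)
Definition coupled (n N : nat) (x y : nat -> int) : Prop :=
  exists Q : nat -> nat -> Prop,
    [/\ forall i j, Q i j -> `|x i - y j| < n%:Z,
        forall i j i' j', Q i j -> Q i' j' -> (i < i')%N -> (j <= j')%N,
        forall i, (i <= N)%N -> exists2 j, (j <= N)%N & Q i j &
        forall j, (j <= N)%N -> exists i, Q i j].

(** Both patterns have [6 * n] letters. From [l], the ascent ends at [l + 6n]; the dip peaks at
    [l + 2n] and ends at [l - 2n], margins wide enough to survive an error below [n]. *)
Definition ascent (n : nat) : seq bool := nseq (6 * n) true.
Definition dip (n : nat) : seq bool := nseq (2 * n) true ++ nseq (4 * n) false.

(** The dip forces [y] above [l + n] at [j1] and then below [l - n] at [j2]. Comparison with the
    other schedule puts [j2] between the start and the end of the ascent, where [y] exceeds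
    [l - n]. *)
Lemma ascent_dip_incompatible (n N : nat) (l : int) (y : nat -> int)
    (a b a' b' : seq bool) :
  first_hit l a -> first_hit l a' ->
  size (a ++ ascent n ++ b) = N -> size (a' ++ dip n ++ b') = N ->
  coupled n N (fun i => pos (take i (a ++ ascent n ++ b))) y ->
  coupled n N (fun i => pos (take i (a' ++ dip n ++ b'))) y -> False.
Proof.
move=> [al ale] [al' ale'].
rewrite !size_cat !size_nseq => sN sN' [Q [Qn Qm Ql Qr]] [Q' [Qn' Qm' Ql' Qr']].
pose x i := pos (take i (a ++ ascent n ++ b)).
pose x' i := pos (take i (a' ++ dip n ++ b')).
have {}Qn i j : Q i j -> `|x i - y j| < n%:Z by apply: Qn.
have {}Qn' i j : Q' i j -> `|x' i - y j| < n%:Z by apply: Qn'.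
have x_le i : (i <= size a)%N -> x i <= l by move=> ia; rewrite /x takel_cat.
have x_up i : (i <= 6 * n)%N -> x (size a + i)%N = l + i%:Z.
  move=> i6; rewrite /x take_cat ltnNge leq_addr /= addKn pos_cat al takel_cat ?size_nseq//.
  by rewrite take_nseq// pos_nseq.
have x'_le i : (i <= size a' + 6 * n)%N -> x' i <= l + (2 * n)%:Z.
  move=> ia; rewrite /x' catA takel_cat ?size_cat ?size_nseq; last lia.
  apply: pos_take_cat_le => // j; rewrite (le_trans (pos_le_count _))// lez_nat.
  rewrite (@leq_trans (count id (dip n)))//; last by rewrite count_cat !count_nseq /= mul1n addn0.
  by rewrite -{2}(cat_take_drop j (dip n)) count_cat leq_addr.
have x'_top : x' (size a' + 2 * n)%N = l + (2 * n)%:Z.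
  rewrite /x' take_cat ltnNge leq_addr /= addKn pos_cat al' takel_cat ?size_cat ?size_nseq; last lia.
  by rewrite takel_cat ?size_nseq// take_nseq// pos_nseq.
have x'_bot : x' (size a' + 6 * n)%N = l - (2 * n)%:Z.
  rewrite /x' take_cat ltnNge leq_addr /= addKn pos_cat al' take_size_cat.
    by rewrite pos_cat !pos_nseq; lia.
  by rewrite size_cat !size_nseq; lia.
have [j1 j1N Q1] : exists2 j, (j <= N)%N & Q' (size a' + 2 * n)%N j by apply: Ql'; lia.
have [j2 j2N Q2] : exists2 j, (j <= N)%N & Q' (size a' + 6 * n)%N j by apply: Ql'; lia.
have [k0 k0N R0] : exists2 j, (j <= N)%N & Q (size a) j by apply: Ql; lia.
have [k1 k1N R1] : exists2 j, (j <= N)%N & Q (size a + 6 * n)%N j by apply: Ql; lia.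
have y1 := Qn' _ _ Q1; rewrite x'_top in y1.
have y2 := Qn' _ _ Q2; rewrite x'_bot in y2.
have z1 := Qn _ _ R1; rewrite x_up// in z1.
have n0 : (0 < n)%N by lia.
have j12 : (j1 <= j2)%N by apply: (Qm' _ _ _ _ Q1 Q2); lia.
(* Up to [k0] the pairing with the ascending word keeps [y] below [l + n], but [y j1 > l + n]. *)
have k0j1 : (k0 < j1)%N.
  have [//|j1k0] := ltnP k0 j1.
  have [i [iQ ia]] : exists i, Q i j1 /\ (i <= size a)%N.
    (* A [j] may be paired with several [i]; when [j1 = k0] the pairing with [size a] is the one to
       use. *)
    have [<-|ne] := eqVneq k0 j1; first by exists (size a).
    have [i iQ] := Qr _ j1N; exists i; split=> //; rewrite leqNgt; apply/negP => ai.
    by have := Qm _ _ _ _ R0 iQ ai; lia.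
  by have := Qn _ _ iQ; have := x_le _ ia; lia.
(* Up to [j2] the pairing with the dipping word keeps [y] below [l + 3n], but [y k1 > l + 5n]. *)
have j2k1 : (j2 < k1)%N.
  have [//|k1j2] := ltnP j2 k1.
  have [i [iQ ia]] : exists i, Q' i k1 /\ (i <= size a' + 6 * n)%N.
    have [<-|ne] := eqVneq j2 k1; first by exists (size a' + 6 * n)%N.
    have [i iQ] := Qr' _ k1N; exists i; split=> //; rewrite leqNgt; apply/negP => ai.
    by have := Qm' _ _ _ _ Q2 iQ ai; lia.
  by have := Qn' _ _ iQ; have := x'_le _ ia; lia.
have [i iQ] := Qr _ j2N.
have ai : (size a <= i)%N.
  by rewrite leqNgt; apply/negP => ai; have := Qm _ _ _ _ iQ R0 ai; lia.
have ia : (i <= size a + 6 * n)%N.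
  by rewrite leqNgt; apply/negP => ia; have := Qm _ _ _ _ R1 iQ ia; lia.
have := Qn _ _ iQ; rewrite -(subnKC ai) x_up; lia.
Qed.

(** * Cost of avoiding one pattern at each level *)

Section AvoidPatterns.
Variables (R : realFieldType) (L m K : nat) (p : nat -> seq bool).
Variable E : seq bool -> Prop.
Hypothesis mL : (m < L)%N.
Hypothesis size_p : forall k, size (p k) = m.
Hypothesis E_reach : forall w, E w -> exists i, (K * L)%:Z <= pos (take i w).
Hypothesis E_avoid : forall w k a b,
  E w -> (k < K)%N -> w = a ++ p k ++ b -> ~ first_hit (k * L)%:Z a.

Let q : R := 1 - 2 ^- m.

Let q_ge0 : 0 <= q.
Proof. by rewrite subr_ge0 invf_le1 ?exprn_gt0// exprn_ege1// ler1n. Qed.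

Let q_le1 : q <= 1.
Proof. by rewrite gerBl invr_ge0 exprn_ge0. Qed.

(* Two states of a word: either level k was the last one reached and its pattern
   has already been broken, or a has just reached level k, the part r of its
   pattern has been read, and s is still to come. *)
Lemma mean_avoid_step (N : nat) :
  (forall k a, (k < K)%N -> (forall i, pos (take i a) < (k.+1 * L)%:Z) ->
     mean N (fun w => `[< E (a ++ w) >]%:R) <= q ^+ (K - k.+1)) /\
  (forall k a r s, (k < K)%N -> first_hit (k * L)%:Z a -> p k = r ++ s ->
     mean N (fun w => `[< E (a ++ r ++ w) >]%:R) <=
     (1 - 2 ^- size s) * q ^+ (K - k.+1)).
Proof.
(* Since [m < L], a pattern begun at level [k] is over before level [k + 1] can be reached. *)
have below k a r s i : first_hit (k * L)%:Z a -> p k = r ++ s ->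
    pos (take i (a ++ r)) < (k.+1 * L)%:Z.
  move=> [al ale] prs; have := size_p k; rewrite prs size_cat => srs.
  have le_r j : pos (take j r) <= (size r)%:Z.
    by rewrite (le_trans (pos_le_size _))// lez_nat size_take_min geq_minr.
  have r0 : 0 <= (size r)%:Z by [].
  have := pos_take_cat_le r0 al ale le_r i; lia.
have unreached k a : (k < K)%N ->
    (forall i, pos (take i a) < (k.+1 * L)%:Z) -> ~ E a.
  move=> kK alt /E_reach[i iE]; have := alt i; have : (k.+1 * L <= K * L)%N by rewrite leq_mul2r kK orbT.
  lia.
have fullmatch k a r s N' : (k < K)%N -> first_hit (k * L)%:Z a -> p k = r ++ s -> s = [::] ->
    mean N' (fun w => `[< E (a ++ r ++ w) >]%:R) = 0 :> R.
  move=> kK ha prs s0; rewrite (eq_mean (g := fun=> 0)) ?mean_cst// => w _.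
  by case: asboolP => // Ew; case: (E_avoid Ew kK _ ha (b := w)); rewrite prs s0 cats0.
elim: N => [|N [IHw IHm]]; split => [k a kK alt|k a r s kK ha prs] /=.
- by rewrite cats0; case: asboolP => [/(unreached _ _ kK alt)//|_]; exact: exprn_ge0.
- have [s0|_] := eqVneq s [::].
    by have /= -> := fullmatch _ _ _ _ 0%N kK ha prs s0; rewrite s0 expr0 invr1 subrr mul0r.
  rewrite cats0; case: asboolP => [/(unreached _ _ kK)[]|_].
    by move=> i; exact: below ha prs.
  by rewrite mulr_ge0 ?exprn_ge0// subr_ge0 invf_le1 ?exprn_gt0// exprn_ege1// ler1n.
- have step b : mean N (fun w => `[< E (a ++ b :: w) >]%:R) <= q ^+ (K - k.+1).
    under eq_mean do rewrite -cat_rcons.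
    have alast : pos a < (k.+1 * L)%:Z by have := alt (size a); rewrite take_size.
    have [lt|ge] := ltP (pos (rcons a b)) (k.+1 * L)%:Z.
      apply: IHw => // i; have [ia|ia] := leqP i (size a).
        by rewrite -cats1 takel_cat.
      by rewrite take_oversize ?size_rcons.
    (* If level [k] was the last one, the exponent is 0 and the bound is trivial. *)
    have [kK1|kK1] := ltnP k.+1 K; last first.
      rewrite (_ : (K - k.+1)%N = 0%N) ?expr0; last lia.
      by rewrite -{2}(mean_cst N (1 : R)); apply: le_mean => w _; rewrite lern1 leq_b1.
    have ha : first_hit (k.+1 * L)%:Z (rcons a b).
      have ab : pos (rcons a b) = (k.+1 * L)%:Z by move: ge; rewrite pos_rcons; case: b; lia.
      split=> // i; have [ia|ia] := leqP i (size a).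
        by rewrite -cats1 takel_cat// ltW.
      by rewrite take_oversize ?size_rcons// ab.
    (* At a fresh level the whole pattern is still to come; its factor [1 - 2^-m = q] raises the
       exponent by one. *)
    have := IHm _ _ [::] (p k.+1) kK1 ha erefl; rewrite size_p -/q -exprS.
    by rewrite (_ : (K - k.+2).+1 = (K - k.+1)%N)//; lia.
  by have := step true; have := step false; lra.
- case: s prs => [|c s] prs.
    have /= -> := fullmatch _ _ _ _ N.+1 kK ha prs erefl.
    by rewrite expr0 invr1 subrr mul0r.
  have match_c : mean N (fun w => `[< E (a ++ r ++ c :: w) >]%:R) <=
      (1 - 2 ^- size s) * q ^+ (K - k.+1).
    under eq_mean do rewrite -cat_rcons.
    by apply: IHm => //; rewrite prs cat_rcons.
  (* A wrong letter breaks the pattern, so the first state applies: at most [m] letters were read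
     after [a], and level [k + 1] is not yet reached. *)
  have mismatch : mean N (fun w => `[< E (a ++ r ++ ~~ c :: w) >]%:R) <=
      q ^+ (K - k.+1).
    under eq_mean do rewrite -cat_rcons catA.
    apply: IHw => // i; have [ia|ia] := leqP i (size (a ++ r)).
      by rewrite -cats1 catA takel_cat//; exact: below ha prs.
    rewrite take_oversize; last by move: ia; rewrite !size_cat size_rcons addnS.
    have := size_p k; rewrite prs size_cat /= => srs.
    rewrite pos_cat (ha.1); have := pos_le_size (rcons r (~~ c)); rewrite size_rcons; lia.
  (* The next letter matches or breaks the pattern with probability 1/2 each. *)
  have -> : 1 - 2 ^- (size (c :: s)) = (1 + (1 - 2 ^- size s)) / 2 :> R.
    by rewrite exprS invfM; field; rewrite expf_neq0.
  move: match_c mismatch; set Q := q ^+ _; set u := 2 ^- _.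
  by case: c prs => _ /=; lra.
Qed.

Lemma mean_avoid (N : nat) : (0 < K)%N ->
  mean N (fun w => `[< E w >]%:R) <= q ^+ K.
Proof.
move=> K0; have h0 : first_hit (0 * L)%:Z [::].
  by split=> [|i]; rewrite ?pos_nil //= pos_nil.
have := (mean_avoid_step N).2 0%N [::] [::] (p 0%N) K0 h0 erefl.
by rewrite size_p -/q -exprS subn1 prednK.
Qed.

End AvoidPatterns.

(** * Probability that a uniform word is coupled with a fixed sequence *)

Lemma coupledN n N (x y : nat -> int) :
  coupled n N x y -> coupled n N (fun i => - x i) (fun j => - y j).
Proof.
move=> [Q [Qn Qm Ql Qr]]; exists Q; split=> // i j /Qn.
by rewrite -opprD normrN.
Qed.

Lemma mean_coupled_reach (R : realFieldType) (n N K : nat) (y : nat -> int) :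
  (0 < K)%N ->
  mean N (fun w => `[< [/\ size w = N, coupled n N (fun i => pos (take i w)) y &
      exists i, (K * (6 * n).+1)%:Z <= pos (take i w)] >]%:R)
  <= (1 - 2 ^- (6 * n)) ^+ K :> R.
Proof.
pose L := (6 * n).+1 => K0.
(* The pattern forbidden at level k depends on y: the dip if some word coupled
   with y ascends there, and the ascent otherwise. *)
pose feasible k := exists a b, [/\ first_hit (k * L)%:Z a,
  size (a ++ ascent n ++ b) = N &
  coupled n N (fun i => pos (take i (a ++ ascent n ++ b))) y].
pose p k := if `[< feasible k >] then dip n else ascent n.
apply: (@mean_avoid R L (6 * n) K p) => // [k|w []//|w k a b [sw cw _] kK wE ha].
  rewrite /p; case: ifP => _; rewrite ?size_cat !size_nseq; lia.
(* At a feasible level the dip contradicts a witnessing ascent; at an infeasible one an ascent of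
   [w] would itself be a witness. *)
move: wE sw cw; rewrite /p; case: asboolP => [[a' [b' [ha' s' c']]]|nf] -> sw cw.
  exact: ascent_dip_incompatible ha' ha s' sw c' cw.
by apply: nf; exists a, b.
Qed.

(** A word reaches [W = K (6n + 1)], or reaches [-W], or stays strictly in between. Negating both
    walks exchanges the first two cases; the last is the strip bound from 0, where the potential is
    [2 W^2]. *)
Lemma mean_coupled (R : realFieldType) (n N K : nat) (y : nat -> int) :
  (0 < K)%N ->
  mean N (fun w => `[< coupled n N (fun i => pos (take i w)) y >]%:R) <=
  2 * (1 - 2 ^- (6 * n)) ^+ K +
  2 * (1 - (2 * (K * (6 * n).+1)%:R ^+ 2)^-1) ^+ N :> R.
Proof.
move=> K0; set W := (K * _)%N.
pose up y w := [/\ size w = N, coupled n N (fun i => pos (take i w)) y &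
  exists i, W%:Z <= pos (take i w)].
pose strip w := forall i, `|0 + pos (take i w)| < W%:Z.
apply: (@le_trans _ _ (mean N (fun w => `[< up y w >]%:R +
    (`[< up (fun j => - y j) (map negb w) >]%:R + `[< strip w >]%:R)))).
  apply: le_mean => w sw; rewrite -!natrD ler_nat.
  case: asboolP => // cw; case: asboolP => // nu; rewrite add0n.
  case: asboolP => // nd; rewrite add0n; case: asboolP => // -[] i; rewrite add0r.
  rewrite ltr_norml; apply/andP; split; rewrite ltNge; apply/negP => h; last first.
    by apply: nu; split=> //; exists i.
  apply: nd; split; first by rewrite size_map.
  - have -> : (fun i => pos (take i (map negb w))) = (fun i => - pos (take i w)).
      by apply/funext => k; rewrite -map_take pos_negb.
    exact: coupledN.
  - by exists i; rewrite -map_take pos_negb; lia.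
rewrite !meanD (mean_negb _ (fun w => `[< up (fun j => - y j) w >]%:R)).
have := mean_coupled_reach R n N y K0.
have := mean_coupled_reach R n N (fun j => - y j) K0.
have W0 : (0 < W)%N by rewrite muln_gt0 K0.
have z0 : `|0 : int| <= W%:Z by rewrite normr0.
have := mean_strip R N W0 z0; rewrite [0%:~R]mulr0z expr0n subr0.
rewrite -/W -/(up y) -/(up _) => S.
have {}S : mean N (fun w => `[< strip w >]%:R) <=
    2 * (1 - (2 * W%:R ^+ 2)^-1) ^+ N :> R.
  rewrite -(ler_pM2l (_ : 0 < W%:R ^+ 2 :> R)) ?exprn_gt0 ?ltr0n//.
  by rewrite (le_trans S)// [leRHS]mulrCA mulrA.
move: S; rewrite /up /strip; lra.
Qed.

(** By [1 - u <= exp (- u)] both terms become exponentials. As [K^3 <= N], the strip exponent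
    [N / (2 K^2 L^2)] is at least [K / (2 L^2)], so both are linear in [K], and [a] is the smaller
    rate. *)
Lemma mean_coupled_expR (R : realType) (n : nat) :
  exists2 a : R, 0 < a & forall (N K : nat) (y : nat -> int),
    (0 < K)%N -> (K ^ 3 <= N)%N ->
    mean N (fun w => `[< coupled n N (fun i => pos (take i w)) y >]%:R) <=
    4 * expR (- (a * K%:R)) :> R.
Proof.
pose L : R := (6 * n).+1%:R; have L1 : 1 <= L by rewrite ler1n.
have L0 : 0 < L by lra.
pose a : R := Num.min (2 ^- (6 * n)) (2 * L ^+ 2)^-1.
have pow_expR (u : R) k : 0 <= u -> u <= 1 -> (1 - u) ^+ k <= expR (- (u * k%:R)).
  move=> u0 u1; rewrite mulrC -mulrN expRM_natl lerXn2r ?nnegrE ?expR_ge0//; first lra.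
  exact: expR_ge1Dx.
exists a; first by rewrite lt_min !invr_gt0 mulr_gt0 ?exprn_gt0//.
move=> N K y K0 KN; apply: (le_trans (mean_coupled _ _ _ _ K0)).
have K0' : 0 < K%:R :> R by rewrite ltr0n.
have H1 : (1 - 2 ^- (6 * n)) ^+ K <= expR (- (a * K%:R)).
  apply: le_trans (pow_expR _ _ _ _) _; rewrite ?invr_ge0 ?exprn_ge0//.
    by rewrite invf_le1 ?exprn_gt0// exprn_ege1// ler1n.
  by rewrite ler_expR lerN2 ler_pM2r// ge_min lexx.
have H2 : (1 - (2 * (K * (6 * n).+1)%:R ^+ 2)^-1) ^+ N <= expR (- (a * K%:R)).
  have KL : 1 <= (K * (6 * n).+1)%:R ^+ 2 :> R by rewrite exprn_ege1// ler1n muln_gt0 K0.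
  apply: le_trans (pow_expR _ _ _ _) _.
  - by rewrite invr_ge0; lra.
  - by rewrite invf_le1; lra.
  rewrite ler_expR lerN2; apply: (@le_trans _ _ ((2 * L ^+ 2)^-1 * K%:R)).
    by rewrite ler_pM2r// ge_min lexx orbT.
  rewrite -[leRHS]mulrC ler_pdivlMr; last lra.
  rewrite natrM -/L.
  rewrite (_ : _ * _ = K%:R ^+ 3); last by field; rewrite gt_eqF.
  by rewrite -natrX ler_nat.
lra.
Qed.

(** * Walks on a cycle *)

Section Cycle.
Variables (V : finType) (n : nat) (e : rel V) (c : seq V) (x0 : V).
Hypothesis n_gt2 : (2 < n)%N.
Hypothesis size_c : size c = n.
Hypothesis uniq_c : uniq c.
Hypothesis mem_c : forall x, x \in c.
Hypothesis eE : forall x y, e x y = (y == next c x) || (x == next c y).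

(** The covering map from the integers onto the cycle; [x0] is the default value of [nth]. *)
Definition cyc (z : int) : V := nth x0 c `|(z %% n)%Z|%N.

Lemma cyc_mod z z' : (z = z' %[mod n])%Z -> cyc z = cyc z'.
Proof. by rewrite /cyc => ->. Qed.

Lemma cyc_inj z z' : cyc z = cyc z' -> (z = z' %[mod n])%Z.
Proof.
have n0 : n%:Z != 0 by lia.
have := modz_ge0 z n0; have := modz_ge0 z' n0.
have := ltz_pmod z (d := n) ltac:(lia); have := ltz_pmod z' (d := n) ltac:(lia).
move=> h1 h2 h3 h4 /eqP; rewrite nth_uniq ?size_c//; [|lia|lia].
by move=> /eqP; lia.
Qed.

Lemma cyc_index v : cyc (index v c)%:Z = v.
Proof.
have iv : (index v c < n)%N by rewrite -size_c index_mem.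
by rewrite /cyc modz_nat modn_small//= nth_index.
Qed.

Lemma next_cyc z : next c (cyc z) = cyc (z + 1).
Proof.
have n0 : n%:Z != 0 by lia.
have := modz_ge0 z n0; have := ltz_pmod z (d := n) ltac:(lia).
rewrite -(cyc_mod (modzDml z 1 n)) /cyc; set k := (z %% n)%Z => kn k0.
have kc : (`|k| < size c)%N by lia.
rewrite next_nth mem_c index_uniq//.
have := size_c; move: kc; case: c => [//|y p] kc /= sp.
have [kp|kp] := ltnP `|k| (size p).
  rewrite modz_small; last lia.
  have -> : `|(k + 1)%R|%N = `|k|%N.+1 by lia.
  by rewrite /= (set_nth_default y).
rewrite nth_default//.
have -> : k + 1 = n by lia.
by rewrite modzz.
Qed.

Lemma edge_cyc z v : e (cyc z) v -> exists b : bool, v = cyc (z + (if b then 1 else -1)).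
Proof.
rewrite eE => /orP[/eqP ->|/eqP]; first by exists true; rewrite next_cyc.
rewrite -{1}(cyc_index v) next_cyc => /cyc_inj zv; exists false.
rewrite -{1}(cyc_index v); apply: cyc_mod.
by apply/eqP; rewrite -(eqz_modDr 1) subrK; apply/eqP.
Qed.

(** The vertices before and after [v] differ because [2 < n]. This is what caps transition
    probabilities at 1/2. *)
Lemma degree_ge2 v : (2 <= #|[set z | e v z]%SET|)%N.
Proof.
rewrite -(cyc_index v); set z := (index v c)%:Z.
have ne : cyc (z + 1) != cyc (z - 1).
  apply/eqP => /cyc_inj /eqP; rewrite eqz_mod_dvd (_ : _ - _ = 2); last lia.
  by move=> /(dvdn_leq (isT : (0 < 2)%N)); rewrite leqNgt n_gt2.
have <- : #|[set cyc (z + 1); cyc (z - 1)]%SET| = 2%N by rewrite cards2 ne.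
apply/subset_leq_card/fintype.subsetP => x; rewrite !inE eE next_cyc.
by case/orP=> /eqP ->; rewrite ?eqxx// next_cyc subrK eqxx orbT.
Qed.

(** The walk from [v] whose directions are the letters of [s]; it stands still once [s] is
    exhausted. *)
Definition track (v : V) (s : seq bool) (i : nat) : V :=
  cyc ((index v c)%:Z + pos (take i s)).

Lemma track0 v s : track v s 0 = v.
Proof. by rewrite /track take0 pos_nil addr0 cyc_index. Qed.

Lemma walk_track N (w : nat -> V) : (forall i, (i < N)%N -> e (w i) (w i.+1)) ->
  exists s : N.-tuple bool, forall i, (i <= N)%N -> w i = track (w 0%N) s i.
Proof.
elim: N => [|N IH] we.
  by exists [tuple] => -[|//] _; rewrite track0.
have [|s sP] := IH; first by move=> i iN; apply: we; rewrite ltnS ltnW.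
have := we N (ltnSn N); rewrite [w N]sP// => /edge_cyc[b wb].
exists [tuple of rcons s b] => i; rewrite leq_eqVlt ltnS => /orP[/eqP ->|iN] /=.
  by rewrite wb /track take_oversize ?size_tuple// take_oversize ?size_rcons ?size_tuple//
    pos_rcons addrA.
by rewrite /track -cats1 takel_cat ?size_tuple// sP.
Qed.

Lemma schedulable_neq N u v s s' :
  schedulable N (track u s) (track v s') -> u != v.
Proof.
case=> sch [_ _ /(_ 0%N (leq0n _))]; rewrite take0 !track0.
by move=> /eqP.
Qed.

(** A discrete intermediate value argument: the count grows by at most one per letter. Hence a
    schedule visits every index up to [N]. *)
Lemma count_take_surj (T : Type) (a : pred T) (s : seq T) i : (i <= count a s)%N ->
  exists2 k, (k <= size s)%N & count a (take k s) = i.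
Proof.
elim: s i => [|x s IH] i /=; first by rewrite leqn0 => /eqP ->; exists 0%N.
case: i => [|i] h; first by exists 0%N.
case ax : (a x) h => h; [have [k ks <-] := IH i h|have [k ks <-] := IH i.+1 h].
all: by exists k.+1; rewrite //= ax.
Qed.

Lemma pos_takeS s i : `|pos (take i.+1 s) - pos (take i s)| <= 1.
Proof.
have [is_|si] := ltnP i (size s).
  by rewrite (take_nth true)// pos_rcons; case: nth; lia.
by rewrite !take_oversize ?subrr// ltnW.
Qed.

(** The lifted difference of the tokens changes by at most 1 per move, starts strictly between [-n]
    and [n], and is a multiple of [n] only at a collision; so it cannot leave that interval. *)
Lemma schedulable_coupled N u v s s' :
  schedulable N (track u s) (track v s') ->
  coupled n N (fun i => pos (take i s))
    (fun j => (index v c)%:Z - (index u c)%:Z + pos (take j s')).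
Proof.
case=> sch [cN cN' free].
pose D k := (index u c)%:Z + pos (take (count id (take k sch)) s) -
  ((index v c)%:Z + pos (take (count negb (take k sch)) s')).
have Dn k : (k <= size sch)%N -> `|D k| < n%:Z.
  have ndvd j : (j <= size sch)%N -> ~~ (n %| D j)%Z.
    move=> js; apply/negP; rewrite /D => /eqP/[dup] _ h; apply: (free j js).
    by apply: cyc_mod; apply/eqP; rewrite eqz_mod_dvd; apply/eqP.
  elim: k => [_|k IH ks].
    have := index_mem u c; have := index_mem v c; rewrite !mem_c size_c.
    by rewrite /D take0 !take0 pos_nil; lia.
  have := IH (ltnW ks); have := ndvd _ ks.
  have : `|D k.+1 - D k| <= 1.
    rewrite /D (take_nth true ks) -!cats1 !count_cat /=.
    case: nth => /=; rewrite ?addn0 ?addn1.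
      have := pos_takeS s (count id (take k sch)); lia.
    have := pos_takeS s' (count negb (take k sch)); lia.
  move=> h1 h2 h3; rewrite lt_neqAle; apply/andP; split; last lia.
  apply: contra h2 => /eqP h; rewrite -[X in (X %| _)%Z]h -abszE.
  by rewrite dvdzE absz_nat dvdnn.
have mono (a : pred bool) k k' : (k <= k')%N -> (count a (take k sch) <= count a (take k' sch))%N.
  by move=> kk; rewrite -(subnKC kk) takeD count_cat leq_addr.
exists (fun i j => exists k, [/\ (k <= size sch)%N, i = count id (take k sch) &
  j = count negb (take k sch)]); split.
- by move=> _ _ [k [/Dn + -> ->]]; rewrite /D; lia.
- move=> _ _ _ _ [k [_ -> ->]] [k' [_ -> ->]] lt; apply: (mono negb).
  by rewrite leqNgt; apply/negP => /ltnW/(mono id); rewrite leqNgt lt.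
- move=> i; rewrite -{1}cN => /count_take_surj[k ks ki].
  exists (count negb (take k sch)); last by exists k.
  by rewrite -cN' -{2}(take_size sch) mono.
- move=> j; rewrite -{1}cN' => /count_take_surj[k ks kj].
  by exists (count id (take k sch)), k.
Qed.

End Cycle.

(** * Reduction to uniformly distributed words *)

Definition history (T V : Type) (X : nat -> T -> V) (k : nat) (w : nat -> V) : set T :=
  [set t | forall i, (i <= k)%N -> X i t = w i].

Lemma history0 (T V : Type) (X : nat -> T -> V) w :
  history X 0 w = [set t | X 0%N t = w 0%N].
Proof.
apply/seteqP; split=> t /=; first exact.
by move=> h i; rewrite leqn0 => /eqP ->.
Qed.

Lemma historyS (T V : Type) (X : nat -> T -> V) k w :
  history X k.+1 w = history X k w `&` [set t | X k.+1 t = w k.+1].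
Proof.
apply/seteqP; split=> t /= => [h|[h hk] i].
  by split; [move=> i ik; apply: h; rewrite ltnW|exact: h].
by rewrite leq_eqVlt => /orP[/eqP ->//|]; rewrite ltnS; exact: h.
Qed.

Lemma sigma_algebraI (T : Type) (G : set (set T)) (A B : set T) :
  <<s G >> A -> <<s G >> B -> <<s G >> (A `&` B).
Proof.
move=> GA GB; rewrite -(setCK (A `&` B)) setCI -setTD -bigcup2E.
apply: sigma_algebraCD; apply: sigma_algebra_bigcup => -[|[|i]] /=.
- by rewrite -setTD; exact: sigma_algebraCD.
- by rewrite -setTD; exact: sigma_algebraCD.
- exact: sigma_algebra0.
Qed.

Lemma process_history (T : Type) (V : finType) (X : nat -> T -> V) k w :
  process_sigma_algebra X (history X k w).
Proof.
have G i v : process_sigma_algebra X [set t | X i t = v].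
  by apply: sub_sigma_algebra; exists i, v.
elim: k => [|k IH]; first by rewrite history0; exact: G.
by rewrite historyS; apply: sigma_algebraI; [exact: IH|exact: G].
Qed.

Lemma measure_bigsetU_le (d : measure_display) (T : measurableType d) (R : realType)
    (P : probability T R) (I : Type) (r : seq I) (Q : pred I) (F : I -> set T) :
  (forall i, measurable (F i)) ->
  (P (\big[setU/set0]_(i <- r | Q i) F i) <= \sum_(i <- r | Q i) P (F i))%E.
Proof.
move=> mF; elim: r => [|i r IH]; first by rewrite !big_nil measure0.
rewrite !big_cons; case: ifP => // _.
have mU : measurable (\big[setU/set0]_(j <- r | Q j) F j) by exact: bigsetU_measurable.
by rewrite (le_trans (measureU2 P (mF i) mU))// leeD2l.
Qed.

Section History.
Variables (d : measure_display) (T : measurableType d) (R : realType).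
Variables (P : probability T R) (V : finType) (e : rel V) (X : nat -> T -> V).
Hypothesis walkX : random_walk P e X.

Lemma measurable_history k w : measurable (history X k w).
Proof.
case: walkX => mX _ _; elim: k => [|k IH]; first by rewrite history0.
by rewrite historyS; exact: measurableI.
Qed.

Lemma prob_history k w : P (history X k w) =
  (#|V|%:R^-1 * \prod_(i < k) uniform_neighbour R e (w i) (w i.+1))%:E.
Proof.
case: walkX => _ X0 XS; elim: k => [|k IH].
  by rewrite history0 big_ord0 mulr1 X0.
by rewrite historyS big_ord_recr /= mulrA EFinM -IH -XS.
Qed.

End History.

(** A schedule of [N] moves for each token consults the walks at indices up to [N] only. *)
Lemma schedulable_ext (V : finType) N (x x' y y' : nat -> V) :
  (forall i, (i <= N)%N -> x i = x' i) -> (forall i, (i <= N)%N -> y i = y' i) ->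
  schedulable N x y -> schedulable N x' y'.
Proof.
move=> xx yy [s [sN sN' free]]; exists s; split=> // k ks.
have le (a : pred bool) : (count a (take k s) <= count a s)%N.
  by rewrite -{2}(cat_take_drop k s) count_cat leq_addr.
by rewrite -xx -1?sN ?le// -yy -1?sN' ?le//; exact: free.
Qed.

Section Reduction.
Variables (d : measure_display) (T : measurableType d) (R : realType).
Variables (P : probability T R) (V : finType) (e : rel V) (n : nat).
Variables (c : seq V) (x0 : V).
Hypothesis n_gt2 : (2 < n)%N.
Hypothesis size_c : size c = n.
Hypothesis uniq_c : uniq c.
Hypothesis mem_c : forall x, x \in c.
Hypothesis eE : forall x y, e x y = (y == next c x) || (x == next c y).

Local Notation track := (track n c x0).

Lemma card_cycle : #|V| = n.
Proof. by rewrite -size_c -(card_uniqP uniq_c); apply: eq_card => x; rewrite mem_c. Qed.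

Lemma uniform_neighbour_le u v : uniform_neighbour R e u v <= 2^-1.
Proof.
rewrite /uniform_neighbour; case: ifP => _; last by rewrite invr_ge0.
have := degree_ge2 x0 n_gt2 size_c uniq_c mem_c eE u.
by move=> h; rewrite lef_pV2 ?posrE ?ltr0n ?ler_nat//; exact: leq_trans h.
Qed.

Lemma uniform_neighbour_ge0 u v : 0 <= uniform_neighbour R e u v.
Proof. by rewrite /uniform_neighbour; case: ifP => // _; rewrite invr_ge0. Qed.

(** The initial segment as an element of a finite type, so that there are finitely many path
    events. *)
Definition trail N (us : V * N.-tuple bool) : {ffun 'I_N.+1 -> V} :=
  [ffun i : 'I_N.+1 => track us.1 us.2 i].

(** A sequence that leaves the edges has probability 0. Any other one is the trail of some start and
    word, so the sum is at least 1, and each of its [N] steps has probability at most 1/2. *)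
Lemma prob_history_le (X : nat -> T -> V) N (f : {ffun 'I_N.+1 -> V}) :
  random_walk P e X ->
  exists2 r : R, P (history X N (fun i => f (inord i))) = r%:E &
    0 <= r <= n%:R^-1 * 2 ^- N * \sum_(us : V * N.-tuple bool) (f == trail us)%:R.
Proof.
move=> /prob_history -> /=; eexists; first by reflexivity.
set w := fun i => f (inord i).
have h0 : 0 <= n%:R^-1 :> R by rewrite invr_ge0.
rewrite card_cycle mulr_ge0 ?prodr_ge0//=; last first.
  by move=> i _; exact: uniform_neighbour_ge0.
rewrite -mulrA ler_wpM2l//.
have [/forallP we|/forallPn[i ei]] := boolP [forall i : 'I_N, e (w i) (w i.+1)]; last first.
  rewrite (bigD1 i)//= /uniform_neighbour (negbTE ei) mul0r.
  by rewrite mulr_ge0 ?invr_ge0 ?exprn_ge0// sumr_ge0.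
have [|s sw] := @walk_track _ n e c x0 n_gt2 size_c uniq_c mem_c eE N w.
  by move=> i iN; exact: (we (Ordinal iN)).
rewrite (@le_trans _ _ (2 ^- N))//.
  rewrite -exprVn -[in leRHS](card_ord N) -prodr_const.
  by apply: ler_prod => i _; rewrite uniform_neighbour_ge0 uniform_neighbour_le.
rewrite ler_peMr ?invr_ge0 ?exprn_ge0//.
rewrite (bigD1 (w 0%N, s))//= (_ : f == trail _); last first.
  by apply/eqP/ffunP => i; rewrite ffunE /= -sw ?/w ?inord_val// -ltnS.
by rewrite lerDl sumr_ge0.
Qed.

(** The event is a finite union over pairs of paths. The union bound, independence and the bound on
    path probabilities leave a count of pairs of words, which the means express. *)
Lemma prob_schedulable_le (X Y : nat -> T -> V) N :
  random_walk P e X -> random_walk P e Y -> independent_processes P X Y ->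
  (P [set t | schedulable N (X ^~ t) (Y ^~ t)] <=
   (n%:R ^- 2 * \sum_(u : V) \sum_(v : V) mean N (fun s' => mean N (fun s =>
     `[< schedulable N (track u s) (track v s') >]%:R)))%:E)%E.
Proof.
move=> wX wY XY.
pose F : finType := {ffun 'I_N.+1 -> V}.
pose ext (f : F) i := f (inord i).
pose S (p : F * F) := `[< schedulable N (ext p.1) (ext p.2) >].
pose H (p : F * F) := history X N (ext p.1) `&` history Y N (ext p.2).
have -> : [set t | schedulable N (X ^~ t) (Y ^~ t)] = \big[setU/set0]_(p | S p) H p.
  rewrite -bigcup_seq_cond; apply/seteqP; split=> t /=.
    move=> st; pose p : F * F := ([ffun i : 'I_N.+1 => X i t], [ffun i : 'I_N.+1 => Y i t]).
    have [eX eY] : (forall i, (i <= N)%N -> X i t = ext p.1 i) /\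
        (forall i, (i <= N)%N -> Y i t = ext p.2 i).
      by split=> i iN; rewrite /ext ffunE inordK.
    exists p; last by split.
    by rewrite /= mem_index_enum; apply/asboolP; exact: schedulable_ext st.
  move=> [p /= /andP[_ /asboolP Sp] [hX hY]].
  by apply: schedulable_ext Sp => i iN; rewrite ?hX ?hY.
have mH p : measurable (H p).
  by apply: measurableI; [exact: measurable_history wX _ _|exact: measurable_history wY _ _].
apply: (le_trans (measure_bigsetU_le _ _ _ mH)).
pose k : R := n%:R^-1 * 2 ^- N.
pose m (f : F) : R := \sum_(us : V * N.-tuple bool) (f == trail us)%:R.
have k0 : 0 <= k by rewrite mulr_ge0 ?invr_ge0 ?exprn_ge0.
have m0 f : 0 <= m f by rewrite sumr_ge0.
apply: (@le_trans _ _ (\sum_(p | S p) (k ^+ 2 * (m p.1 * m p.2))%:E)%E).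
  apply: lee_sum => p _; rewrite /H XY; try exact: process_history.
  have [a -> /andP[a0 ak]] := prob_history_le p.1 wX.
  have [b -> /andP[b0 bk]] := prob_history_le p.2 wY.
  by rewrite -EFinM lee_fin expr2 mulrACA ler_pM.
rewrite sumEFin lee_fin -mulr_sumr.
have -> : \sum_(p | S p) m p.1 * m p.2 =
    \sum_(us : V * N.-tuple bool) \sum_(vs : V * N.-tuple bool) (S (trail us, trail vs))%:R.
  rewrite big_mkcond /=.
  (* Double counting: each pair of starts and words picks out exactly one pair of trails. *)
  transitivity (\sum_us \sum_vs \sum_(p : F * F)
      if p == (trail us, trail vs) then (S p)%:R : R else 0).
    under [RHS]eq_bigr do rewrite exchange_big.
    rewrite [RHS]exchange_big; apply: eq_bigr => -[f g] _ /=.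
    rewrite /m big_distrlr /=; case: ifP => Sp.
      apply: eq_bigr => us _; apply: eq_bigr => vs _.
      by rewrite xpair_eqE; do 2!case: eqP => _; rewrite ?mulr1 ?mulr0.
    by rewrite big1 // => us _; rewrite big1// => vs _; case: ifP.
  by apply: eq_bigr => us _; apply: eq_bigr => vs _; rewrite -big_mkcond big_pred1_eq.
have Strail us vs : S (trail us, trail vs) = `[< schedulable N (track us.1 us.2) (track vs.1 vs.2) >].
  by apply/asboolP/asboolP; apply: schedulable_ext => i iN; rewrite /ext ffunE inordK.
have -> : \sum_(us : V * N.-tuple bool) \sum_(vs : V * N.-tuple bool) (S (trail us, trail vs))%:R
    = 2 ^+ N * 2 ^+ N * \sum_(u : V) \sum_(v : V) mean N (fun s' => mean N (fun s =>
     `[< schedulable N (track u s) (track v s') >]%:R)) :> R.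
  rewrite -(pair_bigA _ (fun u (s : N.-tuple bool) => \sum_vs (S (trail (u, s), trail vs))%:R)) /=.
  rewrite mulr_sumr; apply: eq_bigr => u _.
  under eq_bigr => s _ do rewrite -(pair_bigA _ (fun v (s' : N.-tuple bool) => (S (trail (u, s), trail (v, s')))%:R)) /=.
  rewrite exchange_big mulr_sumr; apply: eq_bigr => v _ /=.
  rewrite mean_tuple exchange_big -mulrA mulVKf ?expf_neq0// mulr_sumr.
  apply: eq_bigr => s' _; rewrite mean_tuple mulVKf ?expf_neq0//.
  by apply: eq_bigr => s _; rewrite Strail.
rewrite mulrA ler_wpM2r//.
  by rewrite sumr_ge0// => u _; rewrite sumr_ge0// => v _;
    rewrite !mean_tuple mulr_ge0 ?invr_ge0 ?exprn_ge0// sumr_ge0// => s _;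
    rewrite mean_tuple mulr_ge0 ?invr_ge0 ?exprn_ge0// sumr_ge0.
(* The powers of 2 cancel, which leaves [n^-2]. *)
rewrite le_eqVlt; apply/orP; left; apply/eqP; rewrite /k; field.
by rewrite expf_neq0//= pnatr_eq0 -lt0n; lia.
Qed.

End Reduction.

(** * Choice of the number of levels and final constants *)

Lemma cube_root_floor (N : nat) : (1 <= N)%N ->
  exists K, [/\ (0 < K)%N, (K ^ 3 <= N)%N & (N < K.+1 ^ 3)%N].
Proof.
move=> N1; have ex : exists K, (K ^ 3 <= N)%N by exists 0%N.
have ub K : (K ^ 3 <= N)%N -> (K <= N)%N.
  by apply: leq_trans; case: K => // K; rewrite -{1}(expn1 K.+1) leq_pexp2l.
case: (ex_maxnP ex ub) => K KN Kmax; exists K; split=> //.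
  by apply: Kmax; rewrite exp1n.
by rewrite ltnNge; apply/negP => /Kmax; rewrite ltnn.
Qed.

(** [K + 1 <= 2 K] because [K] is positive. *)
Lemma cube_root_le (R : realType) (N K : nat) : (0 < K)%N -> (N < K.+1 ^ 3)%N ->
  N%:R `^ (3%:R^-1) <= 2 * K%:R :> R.
Proof.
move=> K0 NK.
have -> : 2 * K%:R = ((2 * K%:R) ^+ 3) `^ (3%:R^-1) :> R.
  by rewrite -powR_mulrn ?mulr_ge0// -powRrM mulfV// powRr1// mulr_ge0.
apply: ge0_ler_powR; rewrite ?nnegrE ?invr_ge0 ?exprn_ge0 ?mulr_ge0//.
rewrite -natrM -natrX ler_nat (leq_trans (ltnW NK))// leq_exp2r//; lia.
Qed.

(** The factor 4 spoils the exponential bound for small [a k], where [r <= 1 - n^-1] takes over.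
    With rate [a / (8 n)] the target exponent is at most [a k / (4 n)]: this is at most [a k - 2]
    when [a k >= 4], and below [n^-1] otherwise. *)
Lemma stretched_exp_lt (R : realType) (n a k s r : R) :
  1 <= n -> 0 < a -> 0 < s -> s <= 2 * k ->
  r <= 4 * expR (- (a * k)) -> r <= 1 - n^-1 ->
  r < expR (- (a / (8 * n) * s)).
Proof.
move=> n1 a0 s0 sk r4 rn; have n0 : 0 < n by lra.
have ni0 : 0 < n^-1 by rewrite invr_gt0.
have ni1 : n^-1 <= 1 by rewrite invf_le1.
have cE : a / (8 * n) = a * n^-1 / 8 by field; rewrite gt_eqF.
have ak0 : 0 < a * k by rewrite mulr_gt0//; lra.
have cs : a / (8 * n) * s <= a * k * n^-1 / 4.
  rewrite cE (_ : a * k * n^-1 / 4 = a * n^-1 / 8 * (2 * k)); last by field; rewrite gt_eqF.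
  by rewrite ler_wpM2l// divr_ge0// mulr_ge0 ?ltW.
have akn : a * k * n^-1 <= a * k by rewrite ler_piMr// ltW.
have [big|small] := leP 4 (a * k).
  apply: (le_lt_trans r4); apply: (@lt_le_trans _ _ (expR 2 * expR (- (a * k)))).
    rewrite ltr_pM2r ?expR_gt0// -[2]/(1 + 1) expRD.
    have := @expR_gt1Dx R 1 (oner_neq0 _); nra.
  by rewrite -expRD ler_expR; lra.
apply: (le_lt_trans rn); apply: (@lt_le_trans _ _ (1 - a / (8 * n) * s)); last first.
  exact: expR_ge1Dx.
rewrite ltrD2l ltrN2; apply: (le_lt_trans cs).
have : a * k * n^-1 < 4 * n^-1 by rewrite ltr_pM2r.
lra.
Qed.

Theorem theorem3p4 (R : realType) (V : finType) (n : nat) (e : rel V)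
    (Hcycle : is_cycle_graph n e) :
  exists c : R, 0 < c /\
    forall N : nat, (1 <= N)%N ->
    forall (d : measure_display) (T : measurableType d) (P : probability T R)
           (X Y : nat -> T -> V),
      random_walk P e X -> random_walk P e Y -> independent_processes P X Y ->
      (P [set t | schedulable N (X ^~ t) (Y ^~ t)] <
       (expR (- (c * N%:R `^ (3%:R^-1))))%:E)%E.
Proof.
case: Hcycle => n2 [c [size_c uniq_c mem_c eE]].
have /hasP[x0 _ _] : has predT c by rewrite has_predT size_c; lia.
have cV := card_cycle size_c uniq_c mem_c.
have n0 : 0 < n%:R :> R by rewrite ltr0n; lia.
have [a a0 mean_le] := mean_coupled_expR R n.
exists (a / (8 * n%:R)); split; first by rewrite divr_gt0// mulr_gt0.
move=> N N1 d T P X Y wX wY XY.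
have [K [K0 KN NK]] := cube_root_floor N1.
apply: (le_lt_trans (prob_schedulable_le x0 n2 size_c uniq_c mem_c eE N wX wY XY)).
rewrite lte_fin.
pose f u v : R := mean N (fun s' => mean N (fun s =>
  `[< schedulable N (track n c x0 u s) (track n c x0 v s') >]%:R)).
(* The bound holds for each fixed second word, hence after averaging over it. *)
have f_le u v : f u v <= 4 * expR (- (a * K%:R)).
  rewrite -(mean_cst N (4 * expR _)); apply: le_mean => s' _.
  pose y j := (index v c)%:Z - (index u c)%:Z + pos (take j s').
  apply: le_trans (mean_le N K y K0 KN); apply: le_mean => s _.
  rewrite ler_nat; case: asboolP => // sch; case: asboolP => // -[].
  exact: (schedulable_coupled n2 size_c uniq_c mem_c sch).
(* Equal starting vertices already collide. *)
have f_neq u v : f u v <= (u != v)%:R.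
  rewrite -(mean_cst N (_ %:R)); apply: le_mean => s' _.
  rewrite -[leRHS](mean_cst N); apply: le_mean => s _.
  rewrite ler_nat; case: asboolP => // sch.
  by rewrite (schedulable_neq size_c mem_c sch).
apply: (@stretched_exp_lt R n%:R a K%:R).
- by rewrite ler1n; lia.
- by [].
- by rewrite powR_gt0// ltr0n.
- exact: cube_root_le.
- rewrite mulrC ler_pdivrMr ?exprn_gt0//.
  rewrite (@le_trans _ _ (\sum_(u : V) \sum_(v : V) 4 * expR (- (a * K%:R))))//.
    by apply: ler_sum => u _; apply: ler_sum => v _; exact: f_le.
  rewrite !sumr_const cV; set B := 4 * _.
  by rewrite -(mulr_natr B n) -(mulr_natr (B * n%:R) n) -mulrA.
(* Among the [n^2] pairs of starts, [n] coincide, which leaves the fraction [1 - n^-1]. *)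
- rewrite mulrC ler_pdivrMr ?exprn_gt0//.
  rewrite (@le_trans _ _ (\sum_(u : V) \sum_(v : V) (u != v)%:R))//.
    by apply: ler_sum => u _; apply: ler_sum => v _; exact: f_neq.
  rewrite (eq_bigr (fun=> n%:R - 1 : R)) => [|u _].
    rewrite sumr_const cV -(mulr_natr _ n) le_eqVlt; apply/orP; left.
    by apply/eqP; field; rewrite gt_eqF.
  rewrite (bigD1 u)//= eqxx add0r (eq_bigr (fun=> 1)) => [|v]; last by rewrite eq_sym => ->.
  by rewrite sumr_const cardC1 cV -{2}(prednK (ltn_trans _ n2))// -natr1 addrK.
Qed.
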